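(* For all integers $m,n\ge0$ and $Z\in\mathbb{BC}$, $$H_{m,n}(Z,\overline{Z})=(-1)^{m+n}e^{|Z|_{\mathbf{j}}^2}\frac{\partial^{m+n}}{\partial \overline{Z}^m\,\partial Z^n}\left(e^{-|Z|_{\mathbf{j}}^2}\right)$$ and $$H_{m,n}(Z,Z^{\dagger})=(-1)^{m+n}e^{|Z|_{\mathbf{i}}^2}\frac{\partial^{m+n}}{\partial (Z^\dagger)^m\,\partial Z^n}\left(e^{-|Z|_{\mathbf{i}}^2}\right).$$
   Context: Bicomplex numbers: $\mathbb{BC}$ is the commutative real algebra generated by two commuting imaginary units $\mathbf{i},\mathbf{j}$ ($\mathbf{i}^2=\mathbf{j}^2=-1$), with $\mathbf{k}=\mathbf{i}\mathbf{j}$, $\mathbf{k}^2=1$. Put $\mathbf{e}_1=\frac{1+\mathbf{k}}{2}$, $\mathbf{e}_2=\frac{1-\mathbf{k}}{2}$ (idempotents with $\mathbf{e}_1\mathbf{e}_2=0$, $\mathbf{e}_1+\mathbf{e}_2=1$). Each $Z=z_1+\mathbf{j}z_2$ with $z_1,z_2\in\mathbb{C}=\mathbb{C}(\mathbf{i})$ is uniquely $Z=\lambda_1\mathbf{e}_1+\lambda_2\mathbf{e}_2$ with $\lambda_1=z_1-\mathbf{i}z_2$, $\lambda_2=z_1+\mathbf{i}z_2\in\mathbb{C}$. Conjugates: $\overline{Z}=\overline{z_1}+\mathbf{j}\overline{z_2}=\overline{\lambda_2}\mathbf{e}_1+\overline{\lambda_1}\mathbf{e}_2$ and $Z^\dagger=z_1-\mathbf{j}z_2=\lambda_2\mathbf{e}_1+\lambda_1\mathbf{e}_2$.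 Moduli: $|Z|_{\mathbf{j}}^2:=Z\overline{Z}$ and $|Z|_{\mathbf{i}}^2:=ZZ^\dagger$. The bicomplex exponential is $e^{Z}=e^{\lambda_1}\mathbf{e}_1+e^{\lambda_2}\mathbf{e}_2$ (equivalently, its power series). Differential operators: $\frac{\partial}{\partial Z}=\partial_{\lambda_1}\mathbf{e}_1+\partial_{\lambda_2}\mathbf{e}_2$, $\frac{\partial}{\partial\overline{Z}}=\partial_{\overline{\lambda_2}}\mathbf{e}_1+\partial_{\overline{\lambda_1}}\mathbf{e}_2$, $\frac{\partial}{\partial Z^\dagger}=\partial_{\lambda_2}\mathbf{e}_1+\partial_{\lambda_1}\mathbf{e}_2$, with $\partial_\lambda,\partial_{\overline\lambda}$ the usual Wirtinger derivatives, acting componentwise on smooth $f=f_1\mathbf{e}_1+f_2\mathbf{e}_2$ (with $f_1,f_2$ complex-valued functions of $(\lambda_1,\lambda_2)$), e.g. $\frac{\partial f}{\partial \overline Z}=(\partial_{\overline{\lambda_2}}f_1)\mathbf{e}_1+(\partial_{\overline{\lambda_1}}f_2)\mathbf{e}_2$. The bicomplex Hermite polynomials of the first kind in $\overline Z$ and $Z^\dagger$ are, for integers $m,n\ge0$ and $W=\overline Z$ or $W=Z^\dagger$, $$H_{m,n}(Z,W)=\sum_{k=0}^{\min(m,n)}(-1)^k k!\binom{m}{k}\binom{n}{k}Z^{m-k}W^{n-k}.$$ *)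

(* Defs.v *)
From HB Require Import structures.
From mathcomp Require Import all_boot all_order all_algebra.
From mathcomp Require Import complex ring.
From mathcomp Require Import all_classical all_reals all_analysis.
Set Implicit Arguments.
Unset Strict Implicit.
Unset Printing Implicit Defensive.
Import Order.TTheory GRing.Theory Num.Theory.
Import numFieldNormedType.Exports.
Local Open Scope ring_scope.

(* [Bicomplex z1 z2] is z1 + j z2, where z1, z2 lie in C(i) = R[i]. *)
Record bicomplex (R : Type) := Bicomplex { bcz1 : R[i]; bcz2 : R[i] }.

Definition pair_of_bc (R : Type) (Z : bicomplex R) := (bcz1 Z, bcz2 Z).
Definition bc_of_pair (R : Type) (p : R[i] * R[i]) := Bicomplex p.1 p.2.
Lemma pair_of_bcK (R : Type) : cancel (@pair_of_bc R) (@bc_of_pair R).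
Proof. by case. Qed.

HB.instance Definition _ (R : choiceType) := Choice.copy (bicomplex R)
  (can_type (@pair_of_bcK R)).

Section BicomplexAlgebra.
Variable R : realType.
Notation BC := (bicomplex R).
Implicit Types (X Y Z : BC) (a b : R[i]).

Lemma bcP X Y : bcz1 X = bcz1 Y -> bcz2 X = bcz2 Y -> X = Y.
Proof. by case: X Y => [? ?] [? ?] /= -> ->. Qed.

Definition bc_add X Y := Bicomplex (bcz1 X + bcz1 Y) (bcz2 X + bcz2 Y).
Definition bc_opp X := Bicomplex (- bcz1 X) (- bcz2 X).
Definition bc_mul X Y := Bicomplex
  (bcz1 X * bcz1 Y - bcz2 X * bcz2 Y) (bcz1 X * bcz2 Y + bcz2 X * bcz1 Y).
Definition bc_scale a X := Bicomplex (a * bcz1 X) (a * bcz2 X).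

Fact bc_addA : associative bc_add.
Proof. by move=> X Y Z; apply: bcP; rewrite /= addrA. Qed.
Fact bc_addC : commutative bc_add.
Proof. by move=> X Y; apply: bcP; rewrite /= addrC. Qed.
Fact bc_add0 : left_id (Bicomplex 0 0) bc_add.
Proof. by move=> X; apply: bcP; rewrite /= add0r. Qed.
Fact bc_addN : left_inverse (Bicomplex 0 0) bc_opp bc_add.
Proof. by move=> X; apply: bcP; rewrite /= addNr. Qed.

HB.instance Definition _ :=
  GRing.isZmodule.Build BC bc_addA bc_addC bc_add0 bc_addN.

Fact bc_mulA : associative bc_mul.
Proof. by move=> X Y Z; apply: bcP => /=; ring. Qed.
Fact bc_mulC : commutative bc_mul.
Proof. by move=> X Y; apply: bcP => /=; ring. Qed.
Fact bc_mul1 : left_id (Bicomplex 1 0) bc_mul.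
Proof. by move=> X; apply: bcP => /=; ring. Qed.
Fact bc_mulD : left_distributive bc_mul +%R.
Proof. by move=> X Y Z; apply: bcP => /=; ring. Qed.
Fact bc_1neq0 : Bicomplex 1 0 != 0 :> BC.
Proof. by apply/eqP => -[] /eqP; rewrite oner_eq0. Qed.

HB.instance Definition _ := GRing.Zmodule_isComNzRing.Build BC
  bc_mulA bc_mulC bc_mul1 bc_mulD bc_1neq0.

Fact bc_scaleA a b X : bc_scale a (bc_scale b X) = bc_scale (a * b) X.
Proof. by apply: bcP; rewrite /= mulrA. Qed.
Fact bc_scale1 : left_id 1 bc_scale.
Proof. by move=> X; apply: bcP; rewrite /= mul1r. Qed.
Fact bc_scaleDr : right_distributive bc_scale +%R.
Proof. by move=> a X Y; apply: bcP; rewrite /= mulrDr. Qed.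
Fact bc_scaleDl X : {morph bc_scale^~ X : a b / a + b}.
Proof. by move=> a b; apply: bcP; rewrite /= mulrDl. Qed.

HB.instance Definition _ := GRing.Zmodule_isLmodule.Build R[i] BC
  bc_scaleA bc_scale1 bc_scaleDr bc_scaleDl.

Fact bc_scaleAl a X Y : a *: (X * Y) = (a *: X) * Y.
Proof. by apply: bcP => /=; ring. Qed.

HB.instance Definition _ := GRing.Lmodule_isLalgebra.Build R[i] BC bc_scaleAl.

Definition bc_i : BC := Bicomplex 'i%C 0.
Definition bc_j : BC := Bicomplex 0 1.
Definition bc_k : BC := bc_i * bc_j.
Definition bc_e1 : BC := (2^-1 : R[i]) *: (1 + bc_k).
Definition bc_e2 : BC := (2^-1 : R[i]) *: (1 - bc_k).

Definition lambda1 Z : R[i] := bcz1 Z - 'i%C * bcz2 Z.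
Definition lambda2 Z : R[i] := bcz1 Z + 'i%C * bcz2 Z.

Definition bc_conj Z : BC := Bicomplex (conjc (bcz1 Z)) (conjc (bcz2 Z)).
Definition bc_dagger Z : BC := Bicomplex (bcz1 Z) (- bcz2 Z).

(* The squared moduli |Z|_j^2 and |Z|_i^2; they are bicomplex-valued. *)
Definition sqmod_j Z : BC := Z * bc_conj Z.
Definition sqmod_i Z : BC := Z * bc_dagger Z.

Definition cexp (z : R[i]) : R[i] :=
  real_complex R (expR (complex.Re z))
  * Complex (cos (complex.Im z)) (sin (complex.Im z)).

Definition bc_exp Z : BC :=
  cexp (lambda1 Z) *: bc_e1 + cexp (lambda2 Z) *: bc_e2.

(* Partial derivatives of g(x + iy) in the real variables x and y, taken on
   the real and imaginary parts of g separately. *)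
Definition pderx (g : R[i] -> R[i]) (z : R[i]) : R[i] :=
  let: Complex x y := z in
  Complex (derive1 (fun t : R => complex.Re (g (Complex t y))) x)
          (derive1 (fun t : R => complex.Im (g (Complex t y))) x).
Definition pdery (g : R[i] -> R[i]) (z : R[i]) : R[i] :=
  let: Complex x y := z in
  Complex (derive1 (fun t : R => complex.Re (g (Complex x t))) y)
          (derive1 (fun t : R => complex.Im (g (Complex x t))) y).

Definition wirt (g : R[i] -> R[i]) (z : R[i]) : R[i] :=
  2^-1 * (pderx g z - 'i%C * pdery g z).
Definition wirt_conj (g : R[i] -> R[i]) (z : R[i]) : R[i] :=
  2^-1 * (pderx g z + 'i%C * pdery g z).

(* A map f : BC -> BC is f1 e1 + f2 e2, where f1 and f2 are regarded as
   functions of the independent complex variables (l1, l2). *)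
Definition comp1 (f : BC -> BC) (l1 l2 : R[i]) : R[i] :=
  lambda1 (f (l1 *: bc_e1 + l2 *: bc_e2)).
Definition comp2 (f : BC -> BC) (l1 l2 : R[i]) : R[i] :=
  lambda2 (f (l1 *: bc_e1 + l2 *: bc_e2)).

Definition d_Z (f : BC -> BC) (Z : BC) : BC :=
  wirt (fun l => comp1 f l (lambda2 Z)) (lambda1 Z) *: bc_e1
  + wirt (fun l => comp2 f (lambda1 Z) l) (lambda2 Z) *: bc_e2.
Definition d_conj (f : BC -> BC) (Z : BC) : BC :=
  wirt_conj (fun l => comp1 f (lambda1 Z) l) (lambda2 Z) *: bc_e1
  + wirt_conj (fun l => comp2 f l (lambda2 Z)) (lambda1 Z) *: bc_e2.
Definition d_dagger (f : BC -> BC) (Z : BC) : BC :=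
  wirt (fun l => comp1 f (lambda1 Z) l) (lambda2 Z) *: bc_e1
  + wirt (fun l => comp2 f l (lambda2 Z)) (lambda1 Z) *: bc_e2.

Definition bc_hermite (m n : nat) (Z W : BC) : BC :=
  \sum_(k < (minn m n).+1)
    (-1) ^+ k * (k`! * 'C(m, k) * 'C(n, k))%:R * Z ^+ (m - k) * W ^+ (n - k).

Lemma bc_i_sqr : bc_i ^+ 2 = -1.
Proof.
by rewrite expr2; apply: bcP; rewrite /= -?expr2 ?sqr_i ?mulr0 ?mul0r; ring.
Qed.

Lemma bc_j_sqr : bc_j ^+ 2 = -1.
Proof. by rewrite expr2; apply: bcP => /=; ring. Qed.

Let two_neq0 : (2 : R[i]) != 0. Proof. by rewrite pnatr_eq0. Qed.
Let ii : 'i%C * 'i%C = -1 :> R[i]. Proof. by rewrite -expr2 sqr_i. Qed.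

Lemma bc_idem1E a b : bcz1 (a *: bc_e1 + b *: bc_e2) = 2^-1 * (a + b).
Proof. by rewrite /=; ring. Qed.

Lemma bc_idem2E a b : bcz2 (a *: bc_e1 + b *: bc_e2) = 2^-1 * 'i%C * (a - b).
Proof. by rewrite /=; ring. Qed.

Lemma lambda1_idem a b : lambda1 (a *: bc_e1 + b *: bc_e2) = a.
Proof.
rewrite /lambda1 bc_idem1E bc_idem2E.
rewrite (_ : 'i%C * _ = 'i%C * 'i%C * (2^-1 * (a - b))); last by ring.
by rewrite ii; field.
Qed.

Lemma lambda2_idem a b : lambda2 (a *: bc_e1 + b *: bc_e2) = b.
Proof.
rewrite /lambda2 bc_idem1E bc_idem2E.
rewrite (_ : 'i%C * (_ * _) = 'i%C * 'i%C * (2^-1 * (a - b))); last by ring.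
by rewrite ii; field.
Qed.

Lemma bc_idemE Z : Z = lambda1 Z *: bc_e1 + lambda2 Z *: bc_e2.
Proof.
apply: bcP; rewrite ?bc_idem1E ?bc_idem2E /lambda1 /lambda2; first by field.
rewrite (_ : _ * _ = - ('i%C * 'i%C) * bcz2 Z); last by field.
by rewrite ii opprK mul1r.
Qed.

Lemma bc_daggerE Z : bc_dagger Z = lambda2 Z *: bc_e1 + lambda1 Z *: bc_e2.
Proof.
rewrite [LHS]bc_idemE; congr (_ *: _ + _ *: _);
by rewrite /lambda1 /lambda2 /= mulrN ?opprK.
Qed.

Lemma bc_conjE Z :
  bc_conj Z = conjc (lambda2 Z) *: bc_e1 + conjc (lambda1 Z) *: bc_e2.
Proof.
rewrite [LHS]bc_idemE; congr (_ *: _ + _ *: _); case: Z => [[a b] [c d]];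
by apply/eqP; rewrite eq_complex /=; apply/andP; split; apply/eqP; ring.
Qed.

End BicomplexAlgebra.

(* Main.v *)
Require Import Defs.
From HB Require Import structures.
From mathcomp Require Import all_boot all_order all_algebra.
From mathcomp Require Import complex ring.
From mathcomp Require Import all_classical all_reals all_analysis.
Import Order.TTheory GRing.Theory Num.Theory.
Local Open Scope ring_scope.
Set Implicit Arguments.
Unset Strict Implicit.
Unset Printing Implicit Defensive.

(** Both formulas are the one-variable-pair identity
    d_w^m d_z^n e^(-zw) = (-1)^(m+n) H_(m,n)(z,w) e^(-zw)
    over the complex numbers, with z and w independent, read in each of the two
    idempotent components.

    Why the components separate: the conjugate and the dagger both exchange
    lambda_1 and lambda_2 (up to complex conjugation).  Writing W for either
    one, a function of the form
      F(lambda_1 Z, lambda_1 W) e1 + F(lambda_2 Z, lambda_2 W) e2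
    with F holomorphic in each argument ([idem_lift]) thus has a first
    component that depends on lambda_1 through z and on lambda_2 through w
    only, and conversely for the second.  So d/dZ differentiates F in z
    ([idem_lift_d_Z]), and d/dW, which uses the other lambda in each component
    and is the conjugate Wirtinger derivative exactly when W is the conjugate,
    differentiates F in w ([idem_lift_d_conj], [idem_lift_d_dagger]).  The
    function e^(-ZW) is the lift of e^(-zw).

    Why the scalar identity holds: n derivatives in z turn e^(-zw) into
    (-w)^n e^(-zw).  A derivative in w of q(w) e^(-zw) replaces the polynomial
    q by q' - z q.  The summands d/dw and -z of this operator commute, so its
    m-th power obeys the binomial formula ([iter_deriv_addZ]), and on (-w)^n
    this gives the Hermite sum ([horner_iter_hermite]).

    Finally lambda_1 and lambda_2 are ring morphisms, so they carry the
    bicomplex Hermite polynomial to the complex one, and e^(ZW) cancels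
    e^(-ZW) in each component ([idem_lift_hermite]). *)

(** * Hermite polynomials and powers of the operator q' + c q *)

(** The formula of [bc_hermite] over an arbitrary commutative ring, so that it
    can be transported along the ring morphisms [lambda1] and [lambda2]. *)
Definition hermite (A : comNzRingType) (m n : nat) (z w : A) : A :=
  \sum_(k < (minn m n).+1)
    (-1) ^+ k * (k`! * 'C(m, k) * 'C(n, k))%:R * z ^+ (m - k) * w ^+ (n - k).

Lemma rmorph_hermite (A B : comNzRingType) (f : {rmorphism A -> B})
    (m n : nat) (z w : A) :
  f (hermite m n z w) = hermite m n (f z) (f w).
Proof.
rewrite /hermite rmorph_sum; apply: eq_bigr => k _.
by rewrite !(rmorphM f) !rmorphXn rmorphN1 rmorph_nat.
Qed.

(** Differentiation and multiplication by a constant commute, hence the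
    binomial formula; the induction is Pascal's rule. *)
Lemma iter_deriv_addZ (A : comNzRingType) (c : A) (m : nat) (p : {poly A}) :
  iter m (fun q => q^`() + c *: q) p =
  \sum_(k < m.+1) (c ^+ (m - k) *+ 'C(m, k)) *: p^`(k).
Proof.
elim: m => [|m IH]; first by rewrite big_ord1 /= expr0 scale1r.
rewrite iterS IH (linear_sum (@deriv A)) scaler_sumr.
rewrite [RHS]big_ord_recl [X in _ + X = _]big_ord_recl.
rewrite !bin0 !mulr1n !subn0 scalerA -exprS addrCA; congr (_ + _).
(* With the terms in p and in its derivative of order m + 1 split off, what
   remains is Pascal's rule term by term. *)
rewrite [X in X + _]big_ord_recr [RHS]big_ord_recr /=.
under [X in X + _ + _ = _]eq_bigr do rewrite derivZ -derivnS.
rewrite derivZ -derivnS !subnn !binn addrAC -big_split /=; congr (_ + _).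
apply: eq_bigr => -[i /= im] _.
rewrite /bump !add1n scalerA mulrnAr -exprS subnSK // subSS -scalerDl.
by rewrite -mulrnDr binS addnC.
Qed.

(** The k-th derivative of w^n is k! 'C(n, k) w^(n - k), which turns the
    binomial formula into the Hermite sum. *)
Lemma horner_iter_hermite (A : comNzRingType) (m n : nat) (z w : A) :
  (iter m (fun q => q^`() + (- z) *: q) ((-1) ^+ n *: 'X^n)).[w] =
  (-1) ^+ (m + n) * hermite m n z w.
Proof.
rewrite iter_deriv_addZ horner_sum /hermite mulr_sumr.
(* The binomial formula sums over k <= m; the terms with n < k vanish. *)
have le_min : ((minn m n).+1 <= m.+1)%N by rewrite ltnS geq_minl.
rewrite [RHS](big_ord_widen _ (fun k => (-1) ^+ (m + n) * ((-1) ^+ k *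
  (k`! * 'C(m, k) * 'C(n, k))%:R * z ^+ (m - k) * w ^+ (n - k))) le_min).
rewrite [RHS]big_mkcond; apply: eq_bigr => -[k /=]; rewrite ltnS => km _.
rewrite derivnZ derivnXn !hornerE hornerMn hornerXn ltnS leq_min km /=.
case: leqP => [kn|nk]; last by rewrite ffact_small // mulr0n !mulr0.
rewrite -bin_ffact (exprNn z).
have sgn : (-1) ^+ (m - k) * (-1) ^+ n = (-1) ^+ (m + n) * (-1) ^+ k :> A.
  rewrite -[in RHS](subnK km) !exprD mulrAC.
  rewrite -(mulrA (_ ^+ (m - k)) (_ ^+ k) (_ ^+ k)) -(exprD _ k k).
  by rewrite addnn -mul2n exprM sqrrN !expr1n mulr1.
rewrite -(mulr_natr (_ * z ^+ _)) -(mulr_natr (w ^+ _)) !natrM.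
rewrite [RHS](_ : _ = (-1) ^+ (m + n) * (-1) ^+ k *
  (k`!%:R * 'C(m, k)%:R * 'C(n, k)%:R * z ^+ (m - k) * w ^+ (n - k)));
  last by ring.
by rewrite -sgn; ring.
Qed.

Section BicomplexRodrigues.
Variable R : realType.
Notation C := R[i].
Notation BC := (bicomplex R).

(** * Complex derivatives along real curves *)

Definition curve_derive (h : R -> C) (t : R) (d : C) :=
  is_derive t 1 (fun u => complex.Re (h u)) (complex.Re d) /\
  is_derive t 1 (fun u => complex.Im (h u)) (complex.Im d).

(** Complex differentiability expressed as a chain rule along every
    differentiable real curve.  In this form composition is immediate, products
    need only the real Leibniz rule, and the partial derivatives in x and y are
    the special cases of horizontal and vertical lines. *)
Definition complex_derive (g g' : C -> C) :=
  forall h t d, curve_derive h t d -> curve_derive (g \o h) t (d * g' (h t)).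

Lemma ReM (x y : C) : complex.Re (x * y) =
  complex.Re x * complex.Re y - complex.Im x * complex.Im y.
Proof. by case: x y => [? ?] [? ?]. Qed.

Lemma ImM (x y : C) : complex.Im (x * y) =
  complex.Re x * complex.Im y + complex.Im x * complex.Re y.
Proof. by case: x y => [? ?] [? ?]. Qed.

Lemma complex_derive_cst (c : C) : complex_derive (fun=> c) (fun=> 0).
Proof. by move=> h t d _; rewrite mulr0; split; exact: is_derive_cst. Qed.

Lemma complex_derive_id : complex_derive id (fun=> 1).
Proof. by move=> h t d; rewrite mulr1. Qed.

Lemma complex_deriveD f f' g g' : complex_derive f f' -> complex_derive g g' ->
  complex_derive (fun z => f z + g z) (fun z => f' z + g' z).
Proof.
move=> Hf Hg h t d Hh; have [f1 f2] := Hf _ _ _ Hh; have [g1 g2] := Hg _ _ _ Hh.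
rewrite mulrDr; split.
  rewrite raddfD; have := is_deriveD f1 g1; congr is_derive.
  by apply/funext => u /=; rewrite fctE -raddfD.
rewrite raddfD; have := is_deriveD f2 g2; congr is_derive.
by apply/funext => u /=; rewrite fctE -raddfD.
Qed.

Lemma complex_deriveM f f' g g' : complex_derive f f' -> complex_derive g g' ->
  complex_derive (fun z => f z * g z) (fun z => f' z * g z + f z * g' z).
Proof.
move=> Hf Hg h t d Hh; have [f1 f2] := Hf _ _ _ Hh; have [g1 g2] := Hg _ _ _ Hh.
have -> : d * (f' (h t) * g (h t) + f (h t) * g' (h t)) =
  (d * f' (h t)) * g (h t) + f (h t) * (d * g' (h t)) by ring.
split.
  have := is_deriveB (is_deriveM f1 g1) (is_deriveM f2 g2).
  congr is_derive; first by apply/funext => u /=; rewrite !fctE ReM.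
  by rewrite [complex.Re (_ + _)]raddfD /= !(ReM, ImM) /GRing.scale /=; ring.
have := is_deriveD (is_deriveM f1 g2) (is_deriveM f2 g1).
congr is_derive; first by apply/funext => u /=; rewrite !fctE ImM.
by rewrite [complex.Im (_ + _)]raddfD /= !(ReM, ImM) /GRing.scale /=; ring.
Qed.

Lemma complex_derive_comp f f' g g' :
  complex_derive f f' -> complex_derive g g' ->
  complex_derive (f \o g) (fun z => g' z * f' (g z)).
Proof. by move=> Hf Hg h t d /Hg /Hf; rewrite mulrA. Qed.

Lemma complex_derive_horner (p : {poly C}) :
  complex_derive (horner p) (horner p^`()).
Proof.
elim/poly_ind: p => [|p c IH].
  rewrite (_ : horner 0 = fun=> 0); last by apply/funext => z; rewrite horner0.
  rewrite deriv0 (_ : horner 0 = fun=> 0) //; last first.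
    by apply/funext => z; rewrite horner0.
  exact: complex_derive_cst.
have := complex_deriveD (complex_deriveM IH complex_derive_id)
  (complex_derive_cst c).
congr complex_derive; apply/funext => z; first by rewrite !hornerE.
by rewrite derivMXaddC !hornerE /= addrC.
Qed.

Lemma cexpE (z : C) : cexp z = Complex
  (expR (complex.Re z) * cos (complex.Im z))
  (expR (complex.Re z) * sin (complex.Im z)).
Proof. by apply/eqP; rewrite eq_complex /= !mul0r subr0 addr0 !eqxx. Qed.

Lemma cexpD (x y : C) : cexp (x + y) = cexp x * cexp y.
Proof.
rewrite !cexpE !raddfD /= expRD cosD sinD.
by apply/eqP; rewrite eq_complex /=; apply/andP; split; apply/eqP; ring.
Qed.

Lemma cexp0 : cexp (0 : C) = 1.
Proof. by rewrite cexpE /= expR0 cos0 sin0 mulr1 mulr0. Qed.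

Lemma complex_derive_cexp : complex_derive (@cexp R) (@cexp R).
Proof.
move=> h t d [h1 h2].
have e : is_derive t 1 (fun u => expR (complex.Re (h u)))
  (expR (complex.Re (h t)) * complex.Re d).
  exact: (is_derive1_comp (is_derive_expR (complex.Re (h t))) h1).
have c : is_derive t 1 (fun u => cos (complex.Im (h u)))
  (- sin (complex.Im (h t)) * complex.Im d).
  exact: (is_derive1_comp (is_derive_cos (complex.Im (h t))) h2).
have s : is_derive t 1 (fun u => sin (complex.Im (h u)))
  (cos (complex.Im (h t)) * complex.Im d).
  exact: (is_derive1_comp (is_derive_sin (complex.Im (h t))) h2).
split.
  have := is_deriveM e c; congr is_derive.
    by apply/funext => u; rewrite fctE [(_ \o _) u]cexpE.
  by rewrite ReM cexpE /GRing.scale /=; ring.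
have := is_deriveM e s; congr is_derive.
  by apply/funext => u; rewrite fctE [(_ \o _) u]cexpE.
by rewrite ImM cexpE /GRing.scale /=; ring.
Qed.

Lemma mulii (x : C) : 'i%C * ('i%C * x) = - x.
Proof. by rewrite mulrA -expr2 sqr_i mulN1r. Qed.

Lemma curve_derive1 h t d : curve_derive h t d ->
  Complex (derive1 (fun u => complex.Re (h u)) t)
          (derive1 (fun u => complex.Im (h u)) t) = d.
Proof. by case: d => a b [h1 h2]; rewrite !derive1E !derive_val. Qed.

(** Along a horizontal line the velocity is 1 and along a vertical one it is i,
    so the partial derivatives are g' and i g'. *)
Lemma wirt_complex_derive g g' z : complex_derive g g' -> wirt g z = g' z.
Proof.
case: z => x y Hg.
have Hx : curve_derive (fun t => Complex t y) x 1.
  by split; [exact: is_derive_id|exact: is_derive_cst].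
have Hy : curve_derive (fun t => Complex x t) y 'i%C.
  by split; [exact: is_derive_cst|exact: is_derive_id].
rewrite /wirt /pderx /pdery (curve_derive1 (Hg _ _ _ Hx)).
rewrite (curve_derive1 (Hg _ _ _ Hy)) mulii mul1r.
by field.
Qed.

(** Conjugation turns the vertical line into one of velocity -i, which swaps
    the roles of the two Wirtinger operators. *)
Lemma wirt_conj_complex_derive g g' z :
  complex_derive g g' -> wirt_conj (fun u => g (conjc u)) z = g' (conjc z).
Proof.
case: z => x y Hg.
have Hx : curve_derive (fun t => Complex t (- y)) x 1.
  by split; [exact: is_derive_id|exact: is_derive_cst].
have Hy : curve_derive (fun t => Complex x (- t)) y (- 'i%C).
  split => /=; first by rewrite oppr0; exact: is_derive_cst.
  exact: is_deriveNid.
rewrite /wirt_conj /pderx /pdery (curve_derive1 (Hg _ _ _ Hx)).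
rewrite (curve_derive1 (Hg _ _ _ Hy)) mul1r mulNr mulrN mulii opprK.
by rewrite /=; field.
Qed.

(** * Idempotent components of the bicomplex operators *)

Definition idem_lift (F : C -> C -> C) (Z W : BC) : BC :=
  F (lambda1 Z) (lambda1 W) *: bc_e1 R + F (lambda2 Z) (lambda2 W) *: bc_e2 R.

(** The hypotheses on [sigma] hold for the conjugate (with [s] the complex
    conjugation) and for the dagger (with [s] the identity).  Since [sigma]
    swaps the components, lambda_1 Z enters the first component of the lift
    through the first argument of [F] only. *)
Lemma idem_lift_d_Z (F F1 : C -> C -> C) (sigma : BC -> BC) (s : C -> C) :
  (forall Y, lambda1 (sigma Y) = s (lambda2 Y)) ->
  (forall Y, lambda2 (sigma Y) = s (lambda1 Y)) ->
  (forall w, complex_derive (F^~ w) (F1^~ w)) ->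
  d_Z (fun Y => idem_lift F Y (sigma Y)) = fun Y => idem_lift F1 Y (sigma Y).
Proof.
move=> s1 s2 HF; apply/funext => Y; rewrite /d_Z /comp1 /comp2 /idem_lift.
congr (_ *: _ + _ *: _); rewrite (s1, s2) -(wirt_complex_derive _ (HF _)).
  congr wirt; apply/funext => l.
  by rewrite lambda1_idem lambda1_idem s1 lambda2_idem.
congr wirt; apply/funext => l.
by rewrite lambda2_idem lambda2_idem s2 lambda1_idem.
Qed.

Lemma lambda1_conj (Y : BC) : lambda1 (bc_conj Y) = conjc (lambda2 Y).
Proof. by rewrite bc_conjE lambda1_idem. Qed.

Lemma lambda2_conj (Y : BC) : lambda2 (bc_conj Y) = conjc (lambda1 Y).
Proof. by rewrite bc_conjE lambda2_idem. Qed.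

Lemma lambda1_dagger (Y : BC) : lambda1 (bc_dagger Y) = lambda2 Y.
Proof. by rewrite bc_daggerE lambda1_idem. Qed.

Lemma lambda2_dagger (Y : BC) : lambda2 (bc_dagger Y) = lambda1 Y.
Proof. by rewrite bc_daggerE lambda2_idem. Qed.

(** In the first component, lambda_2 Y occurs only conjugated and only in the
    second argument of [F]; symmetrically in the second component. *)
Lemma idem_lift_d_conj (F F2 : C -> C -> C) :
  (forall z, complex_derive (F z) (F2 z)) ->
  d_conj (fun Y => idem_lift F Y (bc_conj Y)) =
  fun Y => idem_lift F2 Y (bc_conj Y).
Proof.
move=> HF; apply/funext => Y; rewrite /d_conj /comp1 /comp2 /idem_lift.
congr (_ *: _ + _ *: _); rewrite (lambda1_conj, lambda2_conj).
  rewrite -(wirt_conj_complex_derive _ (HF _)).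
  congr wirt_conj; apply/funext => l.
  by rewrite lambda1_idem lambda1_idem lambda1_conj lambda2_idem.
rewrite -(wirt_conj_complex_derive _ (HF _)).
congr wirt_conj; apply/funext => l.
by rewrite lambda2_idem lambda2_idem lambda2_conj lambda1_idem.
Qed.

Lemma idem_lift_d_dagger (F F2 : C -> C -> C) :
  (forall z, complex_derive (F z) (F2 z)) ->
  d_dagger (fun Y => idem_lift F Y (bc_dagger Y)) =
  fun Y => idem_lift F2 Y (bc_dagger Y).
Proof.
move=> HF; apply/funext => Y; rewrite /d_dagger /comp1 /comp2 /idem_lift.
congr (_ *: _ + _ *: _); rewrite (lambda1_dagger, lambda2_dagger).
  rewrite -(wirt_complex_derive _ (HF _)).
  congr wirt; apply/funext => l.
  by rewrite lambda1_idem lambda1_idem lambda1_dagger lambda2_idem.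
rewrite -(wirt_complex_derive _ (HF _)).
congr wirt; apply/funext => l.
by rewrite lambda2_idem lambda2_idem lambda2_dagger lambda1_idem.
Qed.

(** * Iterated derivatives of exp (- z w) *)

(** The polynomial in w that multiplies e^(-zw) in d_w^m d_z^n e^(-zw). *)
Definition gauss_poly (m n : nat) (z : C) : {poly C} :=
  iter m (fun q => q^`() + (- z) *: q) ((-1) ^+ n *: 'X^n).

Definition gauss_derive (m n : nat) (z w : C) : C :=
  (gauss_poly m n z).[w] * cexp (- (z * w)).

Lemma complex_derive_cexpM (c : C) : complex_derive
  (fun z => cexp (- (c * z))) (fun z => - c * cexp (- (c * z))).
Proof.
have := complex_derive_comp complex_derive_cexp
  (complex_deriveM (complex_derive_cst (- c)) complex_derive_id).
congr complex_derive; apply/funext => z; first by rewrite /= mulNr.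
by rewrite mul0r add0r mulr1 !mulNr.
Qed.

(** Without w-derivatives the polynomial factor is (-w)^n, a constant in z, so
    only the exponential is differentiated. *)
Lemma complex_derive_gauss1 (n : nat) (w : C) :
  complex_derive ((gauss_derive 0 n)^~ w) ((gauss_derive 0 n.+1)^~ w).
Proof.
have := complex_deriveM (complex_derive_cst ((-1) ^+ n * w ^+ n))
  (complex_derive_cexpM w).
congr complex_derive; apply/funext => z.
  by rewrite /gauss_derive /gauss_poly /= !hornerE [w * z]mulrC.
rewrite /gauss_derive /gauss_poly /= !hornerE /= [w * z]mulrC !exprS; ring.
Qed.

Lemma complex_derive_gauss2 (m n : nat) (z : C) :
  complex_derive (gauss_derive m n z) (gauss_derive m.+1 n z).
Proof.
have := complex_deriveM (complex_derive_horner (gauss_poly m n z))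
  (complex_derive_cexpM z).
congr complex_derive; apply/funext => w.
rewrite /gauss_derive /gauss_poly iterS -/(gauss_poly m n z) hornerD hornerZ.
by ring.
Qed.

(** * The bicomplex Rodrigues formulas *)

Lemma lambda1_zmod : zmod_morphism (@lambda1 R).
Proof. by move=> X Y; rewrite /lambda1 /=; ring. Qed.

Lemma lambda2_zmod : zmod_morphism (@lambda2 R).
Proof. by move=> X Y; rewrite /lambda2 /=; ring. Qed.

Lemma lambda1_monoid : monoid_morphism (@lambda1 R).
Proof.
split=> [|X Y]; first by rewrite /lambda1 /= mulr0 subr0.
rewrite /lambda1 /=; have := mulii (bcz2 X * bcz2 Y).
move: (bcz1 X) (bcz2 X) (bcz1 Y) (bcz2 Y) => a b c d bd.
by rewrite -bd; ring.
Qed.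

Lemma lambda2_monoid : monoid_morphism (@lambda2 R).
Proof.
split=> [|X Y]; first by rewrite /lambda2 /= mulr0 addr0.
rewrite /lambda2 /=; have := mulii (bcz2 X * bcz2 Y).
move: (bcz1 X) (bcz2 X) (bcz1 Y) (bcz2 Y) => a b c d bd.
by rewrite -bd; ring.
Qed.

HB.instance Definition _ :=
  GRing.isZmodMorphism.Build BC C (@lambda1 R) lambda1_zmod.
HB.instance Definition _ :=
  GRing.isMonoidMorphism.Build BC C (@lambda1 R) lambda1_monoid.
HB.instance Definition _ :=
  GRing.isZmodMorphism.Build BC C (@lambda2 R) lambda2_zmod.
HB.instance Definition _ :=
  GRing.isMonoidMorphism.Build BC C (@lambda2 R) lambda2_monoid.

Lemma bc_lambda_eq (X Y : BC) :
  lambda1 X = lambda1 Y -> lambda2 X = lambda2 Y -> X = Y.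
Proof. by move=> e1 e2; rewrite (bc_idemE X) (bc_idemE Y) e1 e2. Qed.

Lemma lambda1_exp (Y : BC) : lambda1 (bc_exp Y) = cexp (lambda1 Y).
Proof. exact: lambda1_idem. Qed.

Lemma lambda2_exp (Y : BC) : lambda2 (bc_exp Y) = cexp (lambda2 Y).
Proof. exact: lambda2_idem. Qed.

Lemma gauss_derive_hermite (m n : nat) (z w : C) :
  (-1) ^+ (m + n) * cexp (z * w) * gauss_derive m n z w = hermite m n z w.
Proof.
rewrite /gauss_derive horner_iter_hermite.
rewrite [LHS](_ : _ = (-1) ^+ (m + n) * (-1) ^+ (m + n) *
  (cexp (z * w) * cexp (- (z * w))) * hermite m n z w); last by ring.
by rewrite -exprMn mulrNN mulr1 expr1n -cexpD subrr cexp0 !mul1r.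
Qed.

(** The common core of both formulas: [W] is arbitrary here, since no
    derivative is left. *)
Lemma idem_lift_hermite (m n : nat) (Z W : BC) :
  (-1) ^+ (m + n) * bc_exp (Z * W) * idem_lift (gauss_derive m n) Z W =
  bc_hermite m n Z W.
Proof.
apply: bc_lambda_eq;
  rewrite -/(hermite m n Z W) rmorph_hermite -gauss_derive_hermite.
  by rewrite !rmorphM rmorphXn rmorphN1 /= lambda1_exp rmorphM lambda1_idem.
by rewrite !rmorphM rmorphXn rmorphN1 /= lambda2_exp rmorphM lambda2_idem.
Qed.

Lemma bc_expN_lift (Z W : BC) :
  bc_exp (- (Z * W)) = idem_lift (gauss_derive 0 0) Z W.
Proof.
rewrite /bc_exp /idem_lift; congr (_ *: _ + _ *: _);
by rewrite rmorphN rmorphM /gauss_derive /gauss_poly !expr0 scale1r hornerC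
  mul1r.
Qed.

Lemma iter_d_Z_gauss (sigma : BC -> BC) (s : C -> C) (n : nat) :
  (forall Y, lambda1 (sigma Y) = s (lambda2 Y)) ->
  (forall Y, lambda2 (sigma Y) = s (lambda1 Y)) ->
  iter n (@d_Z R) (fun Y => bc_exp (- (Y * sigma Y))) =
  fun Y => idem_lift (gauss_derive 0 n) Y (sigma Y).
Proof.
move=> s1 s2; elim: n => [|n IH].
  by apply/funext => Y; apply: bc_expN_lift.
by rewrite iterS IH (idem_lift_d_Z s1 s2 (complex_derive_gauss1 n)).
Qed.

Lemma iter_d_conj_gauss (m n : nat) :
  iter m (@d_conj R) (fun Y => idem_lift (gauss_derive 0 n) Y (bc_conj Y)) =
  fun Y => idem_lift (gauss_derive m n) Y (bc_conj Y).
Proof.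
elim: m => [//|m IH].
by rewrite iterS IH (idem_lift_d_conj (complex_derive_gauss2 m n)).
Qed.

Lemma iter_d_dagger_gauss (m n : nat) :
  iter m (@d_dagger R) (fun Y => idem_lift (gauss_derive 0 n) Y (bc_dagger Y)) =
  fun Y => idem_lift (gauss_derive m n) Y (bc_dagger Y).
Proof.
elim: m => [//|m IH].
by rewrite iterS IH (idem_lift_d_dagger (complex_derive_gauss2 m n)).
Qed.

End BicomplexRodrigues.

Theorem theorem5p7 (R : realType) (m n : nat) (Z : bicomplex R) :
  bc_hermite m n Z (bc_conj Z) =
    (-1) ^+ (m + n) * bc_exp (sqmod_j Z) *
    iter m (@d_conj R) (iter n (@d_Z R) (fun Y => bc_exp (- sqmod_j Y))) Z
  /\
  bc_hermite m n Z (bc_dagger Z) =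
    (-1) ^+ (m + n) * bc_exp (sqmod_i Z) *
    iter m (@d_dagger R) (iter n (@d_Z R) (fun Y => bc_exp (- sqmod_i Y))) Z.
Proof.
split; rewrite -idem_lift_hermite; congr (_ * _).
  by rewrite (iter_d_Z_gauss n (@lambda1_conj R) (@lambda2_conj R))
    iter_d_conj_gauss.
by rewrite (iter_d_Z_gauss n (s := id) (@lambda1_dagger R) (@lambda2_dagger R))
  iter_d_dagger_gauss.
Qed.
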